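(* Let $\lambda$ be a nonzero complex number and $x$ a complex number. For every integer $n \geq 0$, $$\sum_{m=0}^n \lambda^{n-m}\, C_{m,\lambda}(x)\, S_2(n,m) = \sum_{m=0}^n \binom{n}{m} C_{n-m}(x)\, \frac{\lambda^m}{m+1},$$ where $C_{m,\lambda}(x)$ are the degenerate Cauchy polynomials of the second kind, $C_m(x)$ are the Cauchy polynomials, and $S_2(n,m)$ are the Stirling numbers of the second kind.
   Context: All generating functions are formal power series in $t$; $\log(1+u)=\sum_{k\ge 1}\frac{(-1)^{k-1}}{k}u^k$ and $(1+u)^x=\sum_{k\ge 0}(x)_k\frac{u^k}{k!}$, where $(x)_0=1$ and $(x)_k=x(x-1)\cdots(x-k+1)$ for $k\geq 1$. The Cauchy polynomials $C_n(x)$ are defined by $$\frac{t}{\log(1+t)}(1+t)^x=\sum_{n=0}^\infty C_n(x)\frac{t^n}{n!}.$$ The degenerate Cauchy polynomials of the second kind $C_{n,\lambda}(x)$ are defined by $$\frac{t}{\log\left(1+\frac{1}{\lambda}\log(1+\lambda t)\right)}\left(1+\tfrac{1}{\lambda}\log(1+\lambda t)\right)^x=\sum_{n=0}^\infty C_{n,\lambda}(x)\frac{t^n}{n!}.$$ The Stirling numbers of the second kind $S_2(n,l)$ are defined by $x^n=\sum_{l=0}^n S_2(n,l)(x)_l$ for $n\ge 0$. *)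

(* Defs.v *)
From HB Require Import structures.
From mathcomp Require Import all_boot all_order all_algebra.
From mathcomp Require Import boolp functions reals.
Set Implicit Arguments.
Unset Strict Implicit.
Unset Printing Implicit Defensive.
Import Order.TTheory GRing.Theory Num.Theory.
Local Open Scope ring_scope.

(* [fps F] is F[[t]]; the coefficient of t^n in [f] is [f n].  Addition is that
   of functions, but multiplication is the Cauchy product, hence the alias. *)
Definition fps (F : fieldType) : Type := nat -> F.

HB.instance Definition _ (F : fieldType) := GRing.Zmodule.copy (fps F) (nat -> F).

Section Ring.
Variable F : fieldType.
Implicit Types f g h : fps F.

Definition fps_one : fps F := fun n => (n == 0)%:R.
Definition fps_mul f g : fps F := fun n => \sum_(i < n.+1) f i * g (n - i)%N.

Let trunc n f : {poly F} := \poly_(i < n) f i.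

Let fps_mulE N n f g : (n < N)%N -> fps_mul f g n = (trunc N f * trunc N g)`_n.
Proof.
move=> nN; rewrite coefM; apply: eq_bigr => i _.
by rewrite !coef_poly (leq_ltn_trans _ nN) ?leq_ord// (leq_ltn_trans _ nN) ?leq_subr.
Qed.

Let fps_mulC : commutative fps_mul.
Proof. by move=> f g; apply/funext => n; rewrite !(@fps_mulE n.+1)// mulrC. Qed.

Let fps_mulA : associative fps_mul.
Proof.
move=> f g h; apply/funext => n; rewrite !(@fps_mulE n.+1)//.
transitivity ((trunc n.+1 f * (trunc n.+1 g * trunc n.+1 h))`_n).
  rewrite !coefM; apply: eq_bigr => i _; congr (_ * _).
  by rewrite coef_poly ltnS leq_subr -fps_mulE// ltnS leq_subr.
rewrite mulrA !coefM; apply: eq_bigr => i _; congr (_ * _).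
by rewrite coef_poly ltn_ord -fps_mulE.
Qed.

Let fps_mul1 : left_id fps_one fps_mul.
Proof.
move=> f; apply/funext => n; rewrite /fps_mul big_ord_recl big1 ?addr0.
  by rewrite /fps_one eqxx mul1r subn0.
by move=> i _; rewrite /fps_one mul0r.
Qed.

Let fps_mulDl : left_distributive fps_mul +%R.
Proof.
move=> f g h; apply/funext => n.
rewrite /fps_mul -[RHS]big_split/=; apply: eq_bigr => i _.
exact: mulrDl.
Qed.

Let fps_oner_neq0 : fps_one != 0 :> fps F.
Proof.
apply/eqP => /(congr1 (fun f : fps F => f 0%N)) /eqP.
by rewrite /fps_one eqxx oner_eq0.
Qed.

HB.instance Definition _ := GRing.Zmodule_isComNzRing.Build (fps F)
  fps_mulA fps_mulC fps_mul1 fps_mulDl fps_oner_neq0.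

Lemma coef_fpsM f g n : (f * g) n = \sum_(i < n.+1) f i * g (n - i)%N.
Proof. by []. Qed.

(* the first [n] coefficients of 1 / f *)
Fixpoint fps_inv_seq f (n : nat) : seq F :=
  if n is m.+1 then
    let s := fps_inv_seq f m in
    rcons s ((f 0%N)^-1 * ((m == 0)%:R - \sum_(i < m) s`_i * f (m - i)%N))
  else [::].

Definition fps_unit : {pred fps F} := fun f => f 0%N != 0.

Definition fps_inv f : fps F :=
  if f 0%N != 0 then fun n => (fps_inv_seq f n.+1)`_n else f.

Let size_inv_seq f n : size (fps_inv_seq f n) = n.
Proof. by elim: n => //= n IH; rewrite size_rcons IH. Qed.

Let nth_inv_seq f n i : (i < n)%N -> (fps_inv_seq f n)`_i = (fps_inv_seq f i.+1)`_i.
Proof.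
elim: n => // n IH; rewrite ltnS leq_eqVlt => /predU1P[->//|iltn].
by rewrite [in LHS]/= nth_rcons size_inv_seq iltn IH.
Qed.

Let fps_mulVf : {in fps_unit, left_inverse 1 fps_inv *%R}.
Proof.
move=> f f0; apply/funext => n; rewrite coef_fpsM /fps_inv (f0 : f 0%N != 0).
rewrite big_ord_recr/= nth_rcons size_inv_seq ltnn eqxx subnn mulrAC mulVf// mul1r.
under eq_bigr => i _ do rewrite -/(fps_inv_seq f i.+1) -(nth_inv_seq f (ltn_ord i)).
by rewrite addrC subrK.
Qed.

Let fps_unitPl f g : g * f = 1 -> fps_unit f.
Proof.
move=> /(congr1 (fun f : fps F => f 0%N)); rewrite coef_fpsM big_ord1 => gf1.
apply/eqP => f0; move/eqP: gf1.
by rewrite /= f0 mulr0 eq_sym oner_eq0.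
Qed.

Let fps_inv_out : {in [predC fps_unit], fps_inv =1 id}.
Proof. by move=> f; rewrite inE /fps_inv => /negbTE/= f0; rewrite (f0 : f 0%N != 0 = false). Qed.

HB.instance Definition _ := GRing.ComNzRing_hasMulInverse.Build (fps F)
  fps_mulVf fps_unitPl fps_inv_out.

Lemma fps_unitE f : (f \is a GRing.unit) = (f 0%N != 0).
Proof. by []. Qed.

End Ring.

Section Series.
Variable F : fieldType.
Implicit Types f g u : fps F.

Definition fpsC (c : F) : fps F := fun n => if n is 0 then c else 0.

Definition fpsX : fps F := fun n => (n == 1)%:R.

(* f(u(t)), meaningful when u has no constant term: u ^+ k has then no
   coefficient below degree k, so that the sum may stop at k = n. *)
Definition fps_comp f u : fps F := fun n => \sum_(k < n.+1) f k * (u ^+ k) n.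

Definition falling (x : F) (k : nat) : F := \prod_(i < k) (x - i%:R).

(* log (1 + u) and (1 + u)^x, for u without constant term *)
Definition fps_log1p u : fps F :=
  fps_comp (fun k => if k is j.+1 then (-1) ^+ j / j.+1%:R else 0) u.

Definition fps_pow1p u (x : F) : fps F :=
  fps_comp (fun k => falling x k / k`!%:R) u.

(* g / t, for g without constant term *)
Definition fps_shift g : fps F := fun n => g n.+1.

(* t / g, for g of order exactly 1.  See [fps_tdivP]. *)
Definition fps_tdiv g : fps F := (fps_shift g)^-1.

Definition egf (a : nat -> F) : fps F := fun n => a n / n`!%:R.

Definition cauchy_gf (x : F) : fps F :=
  fps_tdiv (fps_log1p fpsX) * fps_pow1p fpsX x.

Definition cauchy (n : nat) (x : F) : F := n`!%:R * cauchy_gf x n.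

(* (1 / lambda) log (1 + lambda t) *)
Definition deg_log (lambda : F) : fps F :=
  fpsC lambda^-1 * fps_log1p (fpsC lambda * fpsX).

Definition deg_cauchy_gf (lambda x : F) : fps F :=
  fps_tdiv (fps_log1p (deg_log lambda)) * fps_pow1p (deg_log lambda) x.

Definition deg_cauchy (n : nat) (lambda x : F) : F :=
  n`!%:R * deg_cauchy_gf lambda x n.

(* This determines S n l for l <= n in characteristic 0; other values are
   unconstrained.  See [is_stirling2_exists] and [is_stirling2_unique]. *)
Definition is_stirling2 (S : nat -> nat -> F) : Prop :=
  forall (n : nat) (x : F), x ^+ n = \sum_(l < n.+1) S n l * falling x l.

Lemma fps_shiftK g : g 0%N = 0 -> fps_shift g * fpsX = g.
Proof.
move=> g0; apply/funext => -[|n]; rewrite coef_fpsM.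
  by rewrite big_ord1 /fpsX mulr0.
rewrite big_ord_recr/= subnn [fpsX 0]/fpsX mulr0 addr0 big_ord_recr/= subSnn.
rewrite [fpsX 1]/fpsX eqxx mulr1 big1 ?add0r// => i _.
by rewrite /fpsX subSn ?(ltnW (ltn_ord i))// eqSS subn_eq0 leqNgt ltn_ord mulr0.
Qed.

Lemma fps_tdivP g : g 0%N = 0 -> g 1%N != 0 -> fps_tdiv g * g = fpsX.
Proof.
move=> g0 g1; rewrite -{2}(fps_shiftK g0) mulrA mulVr ?mul1r//.
Qed.

Lemma fps_log1p0 u : fps_log1p u 0%N = 0.
Proof. by rewrite /fps_log1p /fps_comp big_ord1 mul0r. Qed.

Lemma fps_log1p1 u : fps_log1p u 1%N = u 1%N.
Proof.
by rewrite /fps_log1p /fps_comp !big_ord_recr big_ord0/= expr1 expr0 invr1 !mul0r !add0r !mul1r.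
Qed.

Lemma deg_log0 lambda : deg_log lambda 0%N = 0.
Proof. by rewrite /deg_log coef_fpsM big_ord1 fps_log1p0 mulr0. Qed.

Lemma deg_log1 lambda : lambda != 0 -> deg_log lambda 1%N = 1.
Proof.
move=> l0; rewrite /deg_log coef_fpsM !big_ord_recr big_ord0/= subn0 mul0r.
rewrite fps_log1p1 coef_fpsM !big_ord_recr big_ord0/= mul0r /fpsX eqxx.
by rewrite mulr1 !addr0 !add0r mulVf.
Qed.

End Series.

Section Check.
Variable F : numFieldType.

Lemma cauchy_gfP (x : F) :
  egf (fun n => cauchy n x) * fps_log1p (fpsX F)
  = fpsX F * fps_pow1p (fpsX F) x.
Proof.
have -> : egf (fun n => cauchy n x) = cauchy_gf x.
  by apply/funext => n; rewrite /egf /cauchy mulrAC divff ?mul1r// pnatr_eq0 -lt0n fact_gt0.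
rewrite /cauchy_gf mulrAC fps_tdivP// ?fps_log1p0// fps_log1p1.
by rewrite /fpsX oner_neq0.
Qed.

Lemma deg_cauchy_gfP (lambda x : F) : lambda != 0 ->
  egf (fun n => deg_cauchy n lambda x) * fps_log1p (deg_log lambda)
  = fpsX F * fps_pow1p (deg_log lambda) x.
Proof.
move=> l0.
have -> : egf (fun n => deg_cauchy n lambda x) = deg_cauchy_gf lambda x.
  by apply/funext => n; rewrite /egf /deg_cauchy mulrAC divff ?mul1r// pnatr_eq0 -lt0n fact_gt0.
rewrite /deg_cauchy_gf mulrAC fps_tdivP// ?fps_log1p0// fps_log1p1.
by rewrite deg_log1// oner_neq0.
Qed.

Lemma is_stirling2_exists : exists S : nat -> nat -> F, is_stirling2 S.
Proof.
pose fix s (n l : nat) {struct n} : nat := match n, l with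
  | 0, 0 => 1%N | 0, _.+1 => 0%N | _.+1, 0 => 0%N
  | n'.+1, l'.+1 => (l * s n' l + s n' l')%N end.
have s0 n l : (n < l)%N -> s n l = 0%N.
  elim: n l => [|n IH] [|l]//= nl; rewrite !IH ?muln0//.
  by rewrite ltnW.
exists (fun n l => (s n l)%:R); elim=> [|n IH] x.
  by rewrite big_ord1 /falling big_ord0 mulr1.
rewrite exprS IH big_distrr/= [RHS]big_ord_recl mul0r add0r.
transitivity (\sum_(l < n.+1) ((s n l)%:R * falling x l.+1
                              + l%:R * (s n l)%:R * falling x l)).
  apply: eq_bigr => l _; rewrite /falling big_ord_recr/=.
  set p := \prod_(_ < _) _; set a := (s n l)%:R.
  by rewrite -[l%:R * a * p]mulrA [l%:R * _]mulrC -[a * p * l%:R]mulrA -mulrDr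
    -mulrDr subrK mulrC mulrA.
rewrite big_split/= [in RHS](eq_bigr (fun l : 'I_n.+1 => (s n l)%:R * falling x l.+1
   + l.+1%:R * (s n l.+1)%:R * falling x l.+1)); last first.
  by move=> l _; rewrite /bump leq0n add1n natrD natrM mulrDl addrC.
rewrite [RHS]big_split/=; congr (_ + _).
rewrite big_ord_recl/= !mul0r add0r [RHS]big_ord_recr/= (s0 n n.+1)// mulr0 mul0r addr0.
exact: eq_bigr.
Qed.

Lemma is_stirling2_unique (S T : nat -> nat -> F) :
  is_stirling2 S -> is_stirling2 T ->
  forall n l, (l <= n)%N -> S n l = T n l.
Proof.
move=> hS hT n; elim/ltn_ind => l IH ln.
have falling0 k : (l < k)%N -> falling (l%:R : F) k = 0.
  by move=> lk; rewrite /falling (bigD1 (Ordinal lk))//= subrr mul0r.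
have fallingl : falling (l%:R : F) l != 0.
  rewrite /falling; apply/prodf_neq0 => i _.
  by rewrite subr_eq0 eqr_nat gtn_eqF.
have E U : is_stirling2 U -> l%:R ^+ n = \sum_(k < l) U n k * falling (l%:R : F) k
                                       + U n l * falling (l%:R : F) l.
  move=> ->; pose G k := U n k * falling (l%:R : F) k.
  rewrite -[LHS](big_mkord xpredT G) -(big_mkord xpredT G) -[U n l * _]/(G l).
  rewrite -big_nat_recr// [LHS](@big_cat_nat _ _ _ l.+1)//=.
  rewrite [X in _ + X]big_nat_cond [X in _ + X]big1 ?addr0// => k.
  by rewrite andbT => /andP[lk _]; rewrite /G falling0 ?mulr0.
have := E S hS; rewrite (E T hT).
rewrite [in RHS](eq_bigr (fun k : 'I_l => T n k * falling l%:R k)).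
  by move=> /addrI/(mulIf fallingl) ->.
by move=> k _; rewrite IH// ltnW// (leq_trans (ltn_ord k)).
Qed.

End Check.

(* Main.v *)
(** Substituting w(t) = (e^(lambda t) - 1) / lambda for t in the generating
    function of the degenerate Cauchy polynomials turns
    (1 / lambda) log (1 + lambda t) into t, and so gives the generating function
    of the Cauchy polynomials times w(t) / t, whose coefficients are those of the
    right-hand side.  The left-hand side comes from the expansion of the powers
    w ^ m, whose coefficients are Stirling numbers because
    (1 + (e^t - 1))^x = e^(x t).  Both substitutions of an exponential into a
    logarithm or a power are computed by differentiating with respect to t. *)

Require Import Defs.
From mathcomp Require Import all_boot all_order all_algebra.
From mathcomp Require Import boolp ring.
From mathcomp Require Import reals complex.
Import GRing.Theory Num.Theory.
Local Open Scope ring_scope.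
Local Open Scope complex_scope.

(** * Coefficients and composition of formal power series *)

Section FpsTheory.
Set Implicit Arguments.
Unset Strict Implicit.

Variable F : fieldType.
Implicit Types (f g u v : fps F) (c : F) (n k : nat).

Lemma coef_fpsD f g n : (f + g) n = f n + g n.
Proof. by []. Qed.

Lemma coef_fpsCM c f n : (fpsC c * f) n = c * f n.
Proof.
rewrite coef_fpsM big_ord_recl/= subn0 big1 ?addr0// => i _.
by rewrite mul0r.
Qed.

Lemma fps_oneE : (1 : fps F) = fpsC 1.
Proof. by apply/funext => -[]. Qed.

Lemma fpsCX c k : fpsC c ^+ k = fpsC (c ^+ k).
Proof.
elim: k => [|k IH]; first by rewrite !expr0 fps_oneE.
rewrite exprS IH; apply/funext => n; rewrite coef_fpsCM exprS.
by case: n => //= n; rewrite mulr0.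
Qed.

Lemma coef_fpsXM f n : (fpsX F * f) n = if n is m.+1 then f m else 0.
Proof.
pose g : fps F := fun n => if n is m.+1 then f m else 0.
by rewrite mulrC -[f in LHS]/(fps_shift g) fps_shiftK.
Qed.

Lemma fpsX_mulI f g : fpsX F * f = fpsX F * g -> f = g.
Proof.
move=> fg; apply/funext => n.
by rewrite -(coef_fpsXM f n.+1) fg coef_fpsXM.
Qed.

Lemma coef_expr_small u k n : u 0%N = 0 -> (n < k)%N -> (u ^+ k) n = 0.
Proof.
move=> u0; elim: k n => // k IH n nk.
rewrite exprS coef_fpsM big1// => -[[|i] ilt _]; first by rewrite u0 mul0r.
rewrite IH ?mulr0//=; rewrite /= ltnS in ilt.
by rewrite -ltnS (leq_trans _ nk)// ltnS ltn_subrL/= (leq_ltn_trans _ ilt).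
Qed.

(** The added terms vanish, because [u ^+ k] has order at least [k]. A bound common to all
    coefficients is what lets sums be exchanged below. *)
Lemma fps_comp_widen N f u n : u 0%N = 0 -> (n <= N)%N ->
  fps_comp f u n = \sum_(k < N.+1) f k * (u ^+ k) n.
Proof.
move=> u0 nN; rewrite /fps_comp.
rewrite (big_ord_widen N.+1 (fun k => f k * (u ^+ k) n))// big_mkcond/=.
apply: eq_bigr => k _; case: ltnP => // nk.
by rewrite coef_expr_small ?mulr0.
Qed.

Lemma fps_comp0 f u : fps_comp f u 0%N = f 0%N.
Proof. by rewrite /fps_comp big_ord1 expr0 mulr1. Qed.

Lemma fps_compD f g u : fps_comp (f + g) u = fps_comp f u + fps_comp g u.
Proof.
apply/funext => n; rewrite coef_fpsD /fps_comp -big_split/=.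
by apply: eq_bigr => k _; rewrite coef_fpsD mulrDl.
Qed.

Lemma fps_compZ c f u : fps_comp (fpsC c * f) u = fpsC c * fps_comp f u.
Proof.
apply/funext => n; rewrite coef_fpsCM /fps_comp big_distrr/=.
by apply: eq_bigr => k _; rewrite coef_fpsCM mulrA.
Qed.

Lemma fps_comp1 u : fps_comp 1 u = 1.
Proof.
apply/funext => n; rewrite /fps_comp big_ord_recl big1 ?addr0.
  by rewrite expr0 mul1r.
by move=> i _; rewrite mul0r.
Qed.

Lemma fps_compXl u : u 0%N = 0 -> fps_comp (fpsX F) u = u.
Proof.
move=> u0; apply/funext => n.
rewrite (@fps_comp_widen n.+1)// !big_ord_recl/= mul0r add0r mul1r expr1.
by rewrite big1 ?addr0// => i _; rewrite mul0r.
Qed.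

Lemma fps_comp_1DX u : u 0%N = 0 -> fps_comp (1 + fpsX F) u = 1 + u.
Proof. by move=> u0; rewrite fps_compD fps_comp1 fps_compXl. Qed.

Lemma fps_compM f g u : u 0%N = 0 ->
  fps_comp (f * g) u = fps_comp f u * fps_comp g u.
Proof.
move=> u0; apply/funext => n.
(* Both sides equal this sum over a full square: on the left only the triangle [i + j <= n] occurs,
   but the remaining terms have [u ^+ (i + j)] of order above [n]. *)
transitivity (\sum_(i < n.+1) \sum_(j < n.+1) f i * g j * (u ^+ (i + j)) n).
  transitivity (\sum_(k < n.+1) \sum_(i < n.+1 | (i < k.+1)%N)
      f i * g (k - i)%N * (u ^+ k) n).
    apply: eq_bigr => k _; rewrite coef_fpsM big_distrl/=.
    by rewrite (big_ord_widen n.+1 (fun i => f i * g (k - i)%N * (u ^+ k) n)).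
  rewrite (exchange_big_dep xpredT)//=; apply: eq_bigr => i _.
  pose G k := f i * g (k - i)%N * (u ^+ k) n.
  rewrite -(big_mkord (fun k => (i < k.+1)%N) G).
  transitivity (\sum_(i <= k < n.+1) G k).
    rewrite (@big_cat_nat _ _ _ i)//=; last exact: ltnW.
    rewrite big_nat_cond big1 ?add0r; last first.
      by move=> k; rewrite ltnS => /andP[/andP[_ ki]]; rewrite leqNgt ki.
    rewrite [LHS]big_nat_cond [RHS]big_nat_cond; apply: eq_bigl => k.
    by rewrite ltnS andbT andbAC andbb.
  (* Reindex by [k = j + i], then extend the range of [j] from [n - i] to [n]. *)
  rewrite -{1}[i : nat]add0n big_addn big_mkord.
  rewrite (big_ord_widen n.+1 (fun k => G (k + i)%N)) ?leq_subr// big_mkcond/=.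
  apply: eq_bigr => j _; rewrite /G addnK [(j + i)%N]addnC; case: ifP => // /negbT.
  rewrite -leqNgt leq_subLR => nij.
  by rewrite coef_expr_small ?mulr0.
rewrite coef_fpsM; under [RHS]eq_bigr => a _.
  rewrite (@fps_comp_widen n f u a)// ?leq_ord// (@fps_comp_widen n g)// ?leq_subr//.
  rewrite big_distrlr; over.
rewrite [RHS]exchange_big/=; apply: eq_bigr => i _.
rewrite [RHS]exchange_big/=; apply: eq_bigr => j _.
rewrite exprD coef_fpsM big_distrr/=; apply: eq_bigr => a _.
by rewrite mulrACA.
Qed.

Lemma fps_compX f u k : u 0%N = 0 -> fps_comp (f ^+ k) u = fps_comp f u ^+ k.
Proof.
move=> u0; elim: k => [|k IH]; first by rewrite !expr0 fps_comp1.
by rewrite !exprS fps_compM// IH.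
Qed.

(** Expanding in powers of [u] reduces this to the compatibility of substitution with powers. *)
Lemma fps_compA f u v : u 0%N = 0 -> v 0%N = 0 ->
  fps_comp (fps_comp f u) v = fps_comp f (fps_comp u v).
Proof.
move=> u0 v0; apply/funext => n; rewrite [LHS]/fps_comp.
under eq_bigr => k _ do
  rewrite (@fps_comp_widen n f u k)// ?leq_ord// big_distrl/=.
rewrite exchange_big/=; apply: eq_bigr => j _.
rewrite -fps_compX// /fps_comp big_distrr/=.
by apply: eq_bigr => k _; rewrite mulrA.
Qed.

(** * The formal derivative *)

Definition fps_deriv f : fps F := fun n => n.+1%:R * f n.+1.

Lemma fps_derivM f g : fps_deriv (f * g) = fps_deriv f * g + f * fps_deriv g.
Proof.
apply/funext => n; rewrite coef_fpsD /fps_deriv !coef_fpsM.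
(* The factor [n + 1] is split as [i + (n + 1 - i)] in each term. *)
transitivity (\sum_(i < n.+2) i%:R * f i * g (n.+1 - i)%N
    + \sum_(i < n.+2) f i * ((n.+1 - i)%:R * g (n.+1 - i)%N)).
  rewrite big_distrr -big_split/=; apply: eq_bigr => i _.
  rewrite -{1}(subnKC (leq_ord i)) natrD; ring.
congr (_ + _); first by rewrite big_ord_recl !mul0r add0r.
rewrite big_ord_recr/= subnn mul0r mulr0 addr0; apply: eq_bigr => i _.
by rewrite subSn ?leq_ord.
Qed.

Lemma fps_derivX u k : fps_deriv (u ^+ k.+1) = fpsC k.+1%:R * u ^+ k * fps_deriv u.
Proof.
elim: k => [|k IH]; first by rewrite expr1 expr0 -fps_oneE !mul1r.
have -> : fpsC k.+2%:R = 1 + fpsC k.+1%:R :> fps F.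
  by apply/funext => -[|n]; rewrite coef_fpsD /= ?addr0// -[k.+2]add1n natrD.
rewrite exprS fps_derivM IH exprS; ring.
Qed.

Lemma fps_deriv_comp f u : u 0%N = 0 ->
  fps_deriv (fps_comp f u) = fps_comp (fps_deriv f) u * fps_deriv u.
Proof.
move=> u0; apply/funext => n.
rewrite [LHS]/fps_deriv [X in _ * X = _]/fps_comp big_ord_recl expr0 mulr0 add0r big_distrr/=.
transitivity (\sum_(k < n.+1) fps_deriv f k * (u ^+ k * fps_deriv u) n).
  apply: eq_bigr => k _; rewrite mulrCA.
  rewrite -[n.+1%:R * _]/(fps_deriv (u ^+ k.+1) n) fps_derivX -mulrA coef_fpsCM.
  by rewrite mulrCA mulrA.
under eq_bigr => k _ do rewrite coef_fpsM big_distrr/=.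
rewrite exchange_big/= coef_fpsM; apply: eq_bigr => a _.
rewrite (@fps_comp_widen n)// ?leq_ord// big_distrl/=.
by apply: eq_bigr => k _; rewrite mulrA.
Qed.

End FpsTheory.

(** * Exponential series and the identity in characteristic zero *)

Section Char0.
Set Implicit Arguments.
Unset Strict Implicit.

Variable F : numFieldType.
Implicit Types (f u : fps F) (a x lambda : F) (n k : nat).

Let factn_neq0 n : n`!%:R != 0 :> F.
Proof. by rewrite pnatr_eq0 -lt0n fact_gt0. Qed.

Lemma egf_deg_cauchy lambda x :
  egf (fun n => deg_cauchy n lambda x) = deg_cauchy_gf lambda x.
Proof. by apply/funext => n; rewrite /egf /deg_cauchy mulrC mulKf. Qed.

Lemma fps_deriv_inj f g : fps_deriv f = fps_deriv g -> f 0%N = g 0%N -> f = g.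
Proof.
move=> fg fg0; apply/funext => -[//|n].
have := congr1 (fun h : fps F => h n) fg; rewrite /fps_deriv.
by apply: mulfI; rewrite pnatr_eq0.
Qed.

(** The series [e^(a t) - 1], with its constant term removed so that it can be substituted. *)
Definition fps_expm1 a : fps F := fun n => if n is 0 then 0 else a ^+ n / n`!%:R.

Lemma fps_deriv_expm1 a : fps_deriv (fps_expm1 a) = fpsC a * (1 + fps_expm1 a).
Proof.
apply/funext => n; rewrite coef_fpsCM coef_fpsD /fps_deriv/=.
have -> : (1 : fps F) n + fps_expm1 a n = a ^+ n / n`!%:R.
  by case: n => [|n]; [rewrite addr0 fact0 divr1 | rewrite [X in X + _]/(0 : F) add0r].
rewrite factS natrM exprS; field.
by rewrite factn_neq0 /= nat1r pnatr_eq0.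
Qed.

Lemma fps_log1p_expm1 a : fps_log1p (fps_expm1 a) = fpsC a * fpsX F.
Proof.
apply: fps_deriv_inj; last by rewrite fps_log1p0 coef_fpsCM mulr0.
rewrite fps_deriv_comp// fps_deriv_expm1.
set L := fun _ => _.
(* [L] is [log (1 + t)]. Under the substitution, [1 + t] becomes the factor [e^(a t)] produced by
   the chain rule, so the derivative is the constant [a]. *)
have HL : fps_deriv L * (1 + fpsX F) = 1.
  apply/funext => n; rewrite mulrDr mulr1 mulrC coef_fpsD coef_fpsXM /fps_deriv /L.
  case: n => [|n]; first by rewrite expr0 !divr1 mulr1 addr0.
  have n2 : n.+2%:R != 0 :> F by rewrite pnatr_eq0.
  have n1 : n.+1%:R != 0 :> F by rewrite pnatr_eq0.
  by rewrite ![_%:R * (_ / _)]mulrC !divfK// exprS mulN1r addNr.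
rewrite mulrCA -fps_comp_1DX// -fps_compM// HL fps_comp1 mulr1.
apply/funext => n; rewrite /fps_deriv coef_fpsCM /fpsX; case: n => [|n].
  by rewrite mul1r mulr1.
by rewrite !mulr0.
Qed.

(** The series [G = (e^(a t))^x] satisfies [G' = a x G] with constant term 1, a recurrence that
    determines its coefficients. *)
Lemma fps_pow1p_expm1 a x n : fps_pow1p (fps_expm1 a) x n = (a * x) ^+ n / n`!%:R.
Proof.
rewrite /fps_pow1p; set G := fps_comp _ _.
have HG : fps_deriv G = fpsC (a * x) * G.
  rewrite /G fps_deriv_comp// fps_deriv_expm1.
  set P := fun _ => _.
  (* [P] is the binomial series [(1 + t)^x]; its equation is the recurrence of the falling
     factorials. *)
  have HP : fps_deriv P * (1 + fpsX F) = fpsC x * P.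
    apply/funext => k; rewrite mulrDr mulr1 mulrC coef_fpsD coef_fpsXM coef_fpsCM.
    rewrite /fps_deriv /P; case: k => [|k].
      rewrite /falling big_ord_recr big_ord0 /=; field; exact: factn_neq0.
    have -> : falling x k.+2 = falling x k.+1 * (x - k.+1%:R).
      by rewrite /falling big_ord_recr.
    rewrite [k.+2`!]factS natrM; field.
    by rewrite factn_neq0 /= ?nat1r -?natrD pnatr_eq0.
  rewrite mulrCA -fps_comp_1DX// -fps_compM// HP fps_compZ mulrA; congr (_ * _).
  by apply/funext => k; rewrite coef_fpsCM; case: k => //= k; rewrite mulr0.
elim: n => [|n IH]; first by rewrite /G fps_comp0 /falling big_ord0 expr0.
have n1 : n.+1%:R != 0 :> F by rewrite pnatr_eq0.
apply: (mulfI n1); rewrite -[LHS]/(fps_deriv G n) HG coef_fpsCM IH.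
rewrite factS natrM exprS; field.
by rewrite factn_neq0 /= nat1r pnatr_eq0.
Qed.

Lemma coef_expm1X (S : nat -> nat -> F) a n k : is_stirling2 S -> a != 0 ->
  (k <= n)%N -> (fps_expm1 a ^+ k) n = k`!%:R * a ^+ n * S n k / n`!%:R.
Proof.
(* [T] solves the claimed formula for [S n k]. Comparing coefficients in
   [(1 + (e^(a t) - 1))^x = e^(a x t)] shows that [T] satisfies the defining property of the
   Stirling numbers, and uniqueness concludes. *)
move=> hS a0 kn; pose T n k : F := n`!%:R / k`!%:R / a ^+ n * (fps_expm1 a ^+ k) n.
have hT : is_stirling2 T.
  move=> m x; have := fps_pow1p_expm1 a x m.
  rewrite exprMn /fps_pow1p /fps_comp => E.
  have am : a ^+ m != 0 by rewrite expf_neq0.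
  have -> : x ^+ m = m`!%:R / a ^+ m * (a ^+ m * x ^+ m / m`!%:R).
    by field; rewrite factn_neq0 am.
  rewrite -E big_distrr/=; apply: eq_bigr => l _; rewrite /T; field.
  by rewrite am factn_neq0.
rewrite (is_stirling2_unique hS hT kn) /T; field.
by rewrite !factn_neq0 expf_neq0.
Qed.

Lemma deg_cauchy_gf_comp lambda x : lambda != 0 ->
  fps_comp (deg_cauchy_gf lambda x) (fpsC lambda^-1 * fps_expm1 lambda)
  = fps_shift (fpsC lambda^-1 * fps_expm1 lambda) * cauchy_gf x.
Proof.
move=> l0; set w := fpsC _ * _.
have w0 : w 0%N = 0 by rewrite /w coef_fpsCM mulr0.
have lX0 : (fpsC lambda * fpsX F) 0%N = 0 by rewrite coef_fpsCM mulr0.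
(* [w] is the compositional inverse of [deg_log lambda]. *)
have dl_w : fps_comp (deg_log lambda) w = fpsX F.
  rewrite /deg_log fps_compZ /fps_log1p fps_compA// fps_compZ fps_compXl//.
  have -> : fpsC lambda * w = fps_expm1 lambda.
    by apply/funext => n; rewrite /w !coef_fpsCM mulVKf.
  rewrite -/(fps_log1p _) fps_log1p_expm1.
  by apply/funext => n; rewrite !coef_fpsCM mulKf.
have := congr1 (fun f => fps_comp f w) (deg_cauchy_gfP x l0).
rewrite egf_deg_cauchy !fps_compM// fps_compXl// /fps_log1p /fps_pow1p.
rewrite !fps_compA ?deg_log0// dl_w -/(fps_log1p _) -/(fps_pow1p _ _) => E.
have TL : fps_tdiv (fps_log1p (fpsX F)) * fps_log1p (fpsX F) = fpsX F.
  by rewrite fps_tdivP ?fps_log1p0// fps_log1p1 /fpsX oner_neq0.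
(* [E] carries the factor [log (1 + t)], which is not a unit. Multiplying by [t], written as
   [(t / log (1 + t)) * log (1 + t)], makes [E] applicable. *)
apply: fpsX_mulI.
rewrite [RHS]mulrA [fpsX F * fps_shift w]mulrC fps_shiftK// /cauchy_gf.
rewrite [RHS]mulrCA -E -{1}TL.
by rewrite -mulrA; congr (_ * _); rewrite mulrC.
Qed.

Lemma sum_deg_cauchy_stirling2 (S : nat -> nat -> F) lambda x n :
  is_stirling2 S -> lambda != 0 ->
  \sum_(m < n.+1) lambda ^+ (n - m) * deg_cauchy m lambda x * S n m
  = \sum_(m < n.+1) 'C(n, m)%:R * cauchy (n - m) x * (lambda ^+ m / m.+1%:R).
Proof.
move=> hS l0.
have := congr1 (fun f : fps F => n`!%:R * f n) (deg_cauchy_gf_comp x l0).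
rewrite /fps_comp coef_fpsM !big_distrr/= => E.
(* In [w ^+ m] the scalar [lambda^-m] meets the [lambda^n] of the exponential, which leaves
   [lambda^(n - m)]. *)
transitivity (\sum_(m < n.+1) n`!%:R * (deg_cauchy_gf lambda x m *
    ((fpsC lambda^-1 * fps_expm1 lambda) ^+ m) n)); last rewrite E.
  apply: eq_bigr => m _; rewrite exprMn fpsCX coef_fpsCM.
  rewrite (coef_expm1X hS)// ?leq_ord// /deg_cauchy exprVn.
  have -> : lambda ^+ n = lambda ^+ (n - m) * lambda ^+ m.
    by rewrite -exprD subnK ?leq_ord.
  field.
  by rewrite factn_neq0 expf_neq0.
(* The coefficient of [t^m] in [w / t] is [lambda^m / (m + 1)!]; its [m!] goes into the binomial
   coefficient. *)
apply: eq_bigr => m _; rewrite /fps_shift coef_fpsCM /fps_expm1 /cauchy factS.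
have := congr1 (fun k : nat => k%:R : F) (bin_fact (leq_ord m)).
rewrite !natrM => <-; rewrite exprS; field.
by rewrite factn_neq0 l0 /= nat1r pnatr_eq0.
Qed.

End Char0.

Theorem theorem2p1 (R : realType) (lambda x : R[i])
    (S2 : nat -> nat -> R[i]) (hS2 : is_stirling2 S2) (hlambda : lambda != 0)
    (n : nat) :
  \sum_(m < n.+1) lambda ^+ (n - m) * deg_cauchy m lambda x * S2 n m
  = \sum_(m < n.+1) 'C(n, m)%:R * cauchy (n - m) x * (lambda ^+ m / m.+1%:R).
Proof. exact: sum_deg_cauchy_stirling2. Qed.
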